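(* Let $n,k$ be integers with $n>2$ and $1<k<n$, and let $s=\left\lfloor \frac{n-2}{k-1}\right\rfloor$. Then the clique number of the 1-skeleton of the polytope $DCMST_{n,k}$ satisfies $$\omega(DCMST_{n,k}) \geq 2^{\left(\sqrt{\left\lfloor \frac{s-1}{2}\right\rfloor}-9\right)/2}.$$
   Context: $K_n$ is the complete graph on an $n$-element vertex set $V$ with edge set $E$, $|E|=d=n(n-1)/2$. For a subgraph $t$ of $K_n$, $x(t)\in\mathbb{R}^d$ (coordinates indexed by $E$) is its characteristic vector: coordinate $1$ for edges of $t$, $0$ otherwise. $DCMST_{n,k}$ is the convex hull of the characteristic vectors of all spanning trees of $K_n$ in which no vertex has degree larger than $k$. The 1-skeleton of a polytope is the graph whose vertices are the polytope's vertices and whose edges are its 1-dimensional faces; $\omega(\cdot)$ denotes its clique number (size of a largest clique). *)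

(* Defs.v *)
From Stdlib Require Import Reals.
From mathcomp Require Import all_boot all_order all_algebra.
From mathcomp Require Import Rstruct.

Set Implicit Arguments. Unset Strict Implicit. Unset Printing Implicit Defensive.
Import GRing.Theory Num.Theory.

Definition Kedge (n : nat) := {e : {set 'I_n} | #|e| == 2}.

Definition adjT (n : nat) (T : {set Kedge n}) : rel 'I_n :=
  fun u v => (u != v) && [exists e in T, val e == [set u; v]].

Definition connectedT (n : nat) (T : {set Kedge n}) : Prop :=
  forall u v : 'I_n, connect (adjT T) u v.

Definition acyclicT (n : nat) (T : {set Kedge n}) : Prop :=
  forall p : seq 'I_n, uniq p -> (2 < size p)%N -> ~~ cycle (adjT T) p.

Definition spanning_tree (n : nat) (T : {set Kedge n}) : Prop :=
  connectedT T /\ acyclicT T.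

Definition degT (n : nat) (T : {set Kedge n}) (v : 'I_n) : nat :=
  #|[set e in T | v \in val e]|.

Definition dc_tree (n k : nat) (T : {set Kedge n}) : Prop :=
  spanning_tree T /\ forall v : 'I_n, (degT T v <= k)%N.
Arguments dc_tree : clear implicits.

Definition charvec (n : nat) (T : {set Kedge n}) : Kedge n -> R :=
  fun e => if e \in T then 1%R else 0%R.

Definition dotE (n : nat) (c x : Kedge n -> R) : R :=
  (\sum_(e : Kedge n) c e * x e)%R.

(* DCMST_{n,k} = conv { charvec T | dc_tree n k T }.
   x is a vertex (0-dimensional face) of DCMST_{n,k}: some linear functional
   attains its maximum over the polytope exactly at x. *)
Definition dcmst_vertex (n k : nat) (x : Kedge n -> R) : Prop :=
  (exists T, dc_tree n k T /\ x = charvec T) /\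
  exists c : Kedge n -> R,
    forall T', dc_tree n k T' ->
      (dotE c (charvec T') <= dotE c x)%R /\
      (dotE c (charvec T') = dotE c x -> charvec T' = x).
Arguments dcmst_vertex : clear implicits.

(* [x, y] is an edge (1-dimensional face) of DCMST_{n,k}: x <> y are points of
   the generating set and some linear functional attains its maximum over the
   polytope exactly on the segment [x, y] (the maximizing face is
   conv(argmax points), so it equals [x,y] iff x, y maximize and every
   maximizing generator lies in [x,y]). *)
Definition dcmst_edge (n k : nat) (x y : Kedge n -> R) : Prop :=
  x <> y /\
  (exists T, dc_tree n k T /\ x = charvec T) /\
  (exists T, dc_tree n k T /\ y = charvec T) /\
  exists c : Kedge n -> R,
    dotE c x = dotE c y /\
    forall T', dc_tree n k T' ->
      (dotE c (charvec T') <= dotE c x)%R /\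
      (dotE c (charvec T') = dotE c x ->
         exists t : R, (0 <= t <= 1)%R /\
           forall e, charvec T' e = ((1 - t) * x e + t * y e)%R).
Arguments dcmst_edge : clear implicits.

Definition skeleton_clique (n k : nat) (Q : {set {set Kedge n}}) : Prop :=
  (forall T, T \in Q -> dc_tree n k T /\ dcmst_vertex n k (charvec T)) /\
  (forall T1 T2, T1 \in Q -> T2 \in Q -> T1 != T2 ->
     dcmst_edge n k (charvec T1) (charvec T2)).
Arguments skeleton_clique : clear implicits.

(* Main.v *)
Require Import Defs.
From Stdlib Require Import Reals Lra.
From mathcomp Require Import all_boot all_order all_algebra.
From mathcomp Require Import Rstruct zify ring lra.

(* Two trees A, B of the family are adjacent as soon as no other feasible tree T
   satisfies A :&: B \subset T \subset A :|: B: maximise chi_A + chi_B - 1.  So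
   it suffices to find 2 ^ q feasible trees that are pairwise in this position.

   Each tree is a path through "core" vertices, each of which carries k - 2
   pendant leaves, so that the degree bound leaves it exactly two path edges.
   The path goes through one cell for every pair i <= j < q.  A cell consists of
   two strands crossing three switches; the end of the first strand is fed back
   to the start of the second one, so that the cell is traversed completely iff
   an even number of its switches are crossed, and otherwise contains a closed
   component.  In the tree of a : 'I_q -> bool the switches have states a i, a j
   and a i (+) a j.  Switches carrying the same bit in neighbouring cells share a
   link vertex, which lies on a strand of the one or of the other according to
   the state; the degree bound then forces their states to agree.

   If T lies between the trees of a and b, counting degrees shows that T comes
   from some choice of switch states, connectedness gives even parity in every
   cell.  If a i <> b i and a j <> b j, the third switch of the cell (i, j) has
   the same state for a and b, so T follows a at both i and j or b at both.
   Hence T is the tree of a or that of b.  There are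
   O(q ^ 2) core vertices, whence the square root. *)

Set Implicit Arguments. Unset Strict Implicit. Unset Printing Implicit Defensive.
Import Order.TTheory GRing.Theory Num.Theory.

(** * Adjacency of vertices *)

Section Adjacency.
Variable n : nat.
Implicit Types A B T : {set Kedge n}.

Lemma charvec_inj : injective (@charvec n).
Proof.
move=> A B eAB; apply/setP=> e; move/(congr1 (fun f => f e)): eAB.
rewrite /charvec; case: (e \in A); case: (e \in B) => // /eqP.
  by rewrite (oner_eq0 R).
by rewrite eq_sym (oner_eq0 R).
Qed.

(** Equals 1 on [A :&: B], 0 where [A] and [B] differ and -1 elsewhere, so that the comparison with
    [A] holds edge by edge. *)
Definition pair_cost A B (e : Kedge n) : R :=
  (charvec A e + charvec B e - 1)%R.

Lemma dotE_pair_cost_swap A B :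
  dotE (pair_cost A B) (charvec A) = dotE (pair_cost A B) (charvec B).
Proof.
apply: eq_bigr => e _; rewrite /pair_cost /charvec.
by case: (e \in A); case: (e \in B); ring.
Qed.

Lemma pair_cost_term A B T e :
  (pair_cost A B e * charvec T e <= pair_cost A B e * charvec A e)%R.
Proof.
by rewrite /pair_cost /charvec; case: (e \in A); case: (e \in B); case: (e \in T); lra.
Qed.

Lemma dotE_pair_cost_le A B T :
  (dotE (pair_cost A B) (charvec T) <= dotE (pair_cost A B) (charvec A))%R.
Proof. by apply: ler_sum => e _; apply: pair_cost_term. Qed.

Lemma dotE_pair_cost_eq A B T :
  dotE (pair_cost A B) (charvec T) = dotE (pair_cost A B) (charvec A) ->
  A :&: B \subset T /\ T \subset A :|: B.
Proof.
move=> eqd.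
have term e : (pair_cost A B e * charvec T e = pair_cost A B e * charvec A e)%R.
  have : (\sum_e (pair_cost A B e * charvec A e -
                  pair_cost A B e * charvec T e) = 0)%R.
    by rewrite sumrB; apply/eqP; rewrite subr_eq0; apply/eqP.
  move/psumr_eq0P => /(_ _ e isT) H; apply/esym/eqP; rewrite -subr_eq0; apply/eqP.
  by apply: H => e' _; rewrite subr_ge0 pair_cost_term.
split; apply/subsetP=> e; move: (term e); rewrite /pair_cost /charvec !inE;
  case: (e \in A); case: (e \in B); case: (e \in T) => //= => H _; exfalso; lra.
Qed.

Lemma skeleton_clique_between k (Q : {set {set Kedge n}}) :
  (forall T, T \in Q -> dc_tree n k T) ->
  (forall A B T, A \in Q -> B \in Q -> A != B -> dc_tree n k T ->
     A :&: B \subset T -> T \subset A :|: B -> T = A \/ T = B) ->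
  skeleton_clique n k Q.
Proof.
move=> Qdc Qadj; split=> [A QA|A B QA QB nAB].
  split; first exact: Qdc.
  split; first by exists A; split=> //; apply: Qdc.
  (* With both trees equal to [A] the cost is 1 on [A] and -1 off it, so [A] is the only
     maximiser. *)
  exists (pair_cost A A) => T dcT; split; first exact: dotE_pair_cost_le.
  move/dotE_pair_cost_eq; rewrite setIid setUid => -[sAT sTA].
  by congr charvec; apply/eqP; rewrite eqEsubset sTA.
split; first by move/charvec_inj/eqP; apply/negP.
split; first by exists A; split=> //; apply: Qdc.
split; first by exists B; split=> //; apply: Qdc.
exists (pair_cost A B); split; first exact: dotE_pair_cost_swap.
move=> T dcT; split; first exact: dotE_pair_cost_le.
move/dotE_pair_cost_eq => [sT Ts]; case: (Qadj A B T) => // ->.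
  by exists 0%R; rewrite lexx ler01; split=> // e; rewrite subr0 mul1r mul0r addr0.
by exists 1%R; rewrite lexx ler01; split=> // e; rewrite subrr mul1r mul0r add0r.
Qed.
End Adjacency.


(** * Spanning trees *)

Section Graphs.
Variable n : nat.
Implicit Types (T : {set Kedge n}) (u v : 'I_n).

Lemma adjT_sym T : symmetric (adjT T).
Proof. by move=> u v; rewrite /adjT eq_sym setUC. Qed.

Lemma card_edge_set u v : u != v -> #|[set u; v]| == 2.
Proof. by rewrite cards2 => ->. Qed.

Definition mkedge u v (uv : u != v) : Kedge n :=
  exist _ [set u; v] (card_edge_set uv).

Lemma adjTP T u v : reflect (exists uv : u != v, mkedge uv \in T) (adjT T u v).
Proof.
apply: (iffP andP) => [[uv /exists_inP [e eT /eqP ee]]|[uv eT]].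
  by exists uv; rewrite (_ : mkedge uv = e) //; apply: val_inj.
by split=> //; apply/exists_inP; exists (mkedge uv).
Qed.

Lemma edgeP (e : Kedge n) : exists u v (uv : u != v), e = mkedge uv.
Proof.
have /cards2P [u [v [uv ee]]] := valP e.
by exists u, v, uv; apply: val_inj.
Qed.

Lemma adjT_sub T T' : (T \subset T') = [forall u, forall v, adjT T u v ==> adjT T' u v].
Proof.
apply/subsetP/'forall_'forall_implyP => [sTT' u v /adjTP [uv eT]|H e eT].
  by apply/adjTP; exists uv; apply: sTT'.
case: (edgeP e) => u [v [uv ee]]; subst e.
have /H/adjTP [uv' eT'] : adjT T u v by apply/adjTP; exists uv.
by rewrite (bool_irrelevance uv uv').
Qed.

Lemma connectedT_closed T (U : {set 'I_n}) u v :
  connectedT T -> (forall x y, adjT T x y -> x \in U -> y \in U) ->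
  u \in U -> v \in U.
Proof.
move=> conT clU uU; have /connectP [p] := conT u v.
elim: p u uU => [|w p IHp] u uU /=; first by move=> _ ->.
by case/andP=> uw pw; apply: IHp pw; apply: clU uw uU.
Qed.

Lemma connectedT_cross T (U : {set 'I_n}) u v :
  connectedT T -> u \in U -> v \notin U ->
  exists x y, [/\ adjT T x y, x \in U & y \notin U].
Proof.
move=> conT uU vU.
case: (boolP [exists x in U, exists y, adjT T x y && (y \notin U)]) => [|nx].
  by case/exists_inP=> x xU /existsP [y /andP [xy yU]]; exists x, y.
case/negP: vU; apply: (@connectedT_closed T U u v conT) uU => x y xy xU.
apply: contraR nx => yU; apply/exists_inP; exists x => //.
by apply/existsP; exists y; rewrite xy.
Qed.

(* Grow a vertex set one crossing edge at a time. *)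
Lemma connectedT_card T : connectedT T -> n <= #|T|.+1.
Proof.
move=> conT; have [n0|n0] := posnP n.
  by apply: (@leq_trans 0) => //; apply/eq_leq.
suff H m : 0 < m -> m <= n -> exists (U : {set 'I_n}) (F : {set Kedge n}),
    [/\ #|U| = m, F \subset T, m <= #|F|.+1 &
      forall e, e \in F -> val e \subset U].
  have [U [F [_ sFT mF _]]] := H n n0 (leqnn n).
  by apply: leq_trans mF _; rewrite ltnS subset_leq_card.
elim: m => // -[_ _ _|m IH _ lemn].
  exists [set Ordinal n0], set0; rewrite cards1 sub0set cards0; split=> // e.
  by rewrite inE.
have [U [F [cU sF mF FU]]] := IH isT (ltnW lemn).
have [u uU] : exists u, u \in U by apply/card_gt0P; rewrite cU.
have [v vU] : exists v, v \notin U.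
  case: (pickP [predC U]) => [v vU|Ue]; first by exists v.
  suff : n <= #|U| by rewrite cU leqNgt lemn.
  rewrite -[X in X <= _](card_ord n) subset_leq_card //.
  by apply/subsetP=> v _; move: (Ue v) => /= /negbFE.
have [x [y [/adjTP [xy eT] xU yU]]] := connectedT_cross conT uU vU.
exists (y |: U), (mkedge xy |: F); split.
- by rewrite cardsU1 yU cU.
- by rewrite subUset sub1set eT.
- rewrite cardsU1 (_ : _ \notin F) //; apply/negP=> /FU /subsetP /(_ y).
  by rewrite !inE eqxx orbT => /(_ isT); apply/negP.
- move=> e; rewrite !inE => /predU1P [->|/FU /subset_trans]; last first.
    by apply; apply: subsetUr.
  by apply/subsetP=> z; rewrite !inE => /pred2P [->|->]; rewrite ?xU ?eqxx ?orbT.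
Qed.

Lemma degT_adjT T v : degT T v = #|[set u | adjT T v u]|.
Proof.
pose other (e : Kedge n) := odflt v [pick u in val e | u != v].
have otherE u (uv : v != u) : other (mkedge uv) = u.
  rewrite /other; case: pickP => [w /andP [] /=|/(_ u)].
    by rewrite !inE => /pred2P [->|->] //; rewrite eqxx.
  by rewrite /= !inE eqxx orbT eq_sym uv.
have incP (e : Kedge n) : v \in val e -> exists u (uv : v != u), e = mkedge uv.
  case: (edgeP e) => u [w [uw ->]] /=; rewrite !inE => /pred2P [vu|vw]; subst.
    by exists w, uw.
  by exists u; have wu : w != u by [rewrite eq_sym]; exists wu; apply: val_inj; rewrite /= setUC.
rewrite /degT -(card_in_imset (f := other)).
  apply: eq_card => u; rewrite !inE; apply/imsetP/adjTP => [[e]|[uv eT]].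
    rewrite inE => /andP [eT /incP [w [vw ee]]] ->.
    by subst e; rewrite otherE; exists vw.
  by exists (mkedge uv); rewrite ?otherE // inE eT /= !inE eqxx.
move=> e1 e2; rewrite !inE => /andP [_ /incP [u1 [vu1 ->]]].
case/andP=> _ /incP [u2 [vu2 ->]]; rewrite !otherE => eu; apply: val_inj => /=.
by rewrite eu.
Qed.

Lemma handshake T : \sum_v degT T v = #|T|.*2.
Proof.
transitivity (\sum_(v : 'I_n) \sum_(e in T) (v \in val e)).
  apply: eq_bigr => v _; rewrite /degT -sum1_card.
  rewrite [RHS]big_mkcond [LHS]big_mkcond; apply: eq_bigr => e _.
  by rewrite inE; case: (e \in T); case: (v \in _).
rewrite exchange_big /= -muln2 -sum_nat_const; apply: eq_bigr => e _.
transitivity #|val e|; last exact/eqP/(valP e).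
rewrite -sum1_card [RHS]big_mkcond.
by apply: eq_bigr => v _; case: (v \in _).
Qed.

(** The degree sums are twice the edge counts, so the two opposite inequalities leave no slack at
    any vertex. *)
Lemma degT_mono_eq T T' : #|T'| <= #|T| ->
  (forall v, degT T v <= degT T' v) -> forall v, degT T v = degT T' v.
Proof.
move=> cTT' degle.
have [_ sumE] : \sum_v degT T v <= \sum_v degT T' v
    ?= iff [forall (v | true), degT T v == degT T' v].
  by apply: leqif_sum => v _; split.
move=> v; apply/eqP.
have /forall_inP : [forall (v | true), degT T v == degT T' v].
  by rewrite -sumE eqn_leq leq_sum //= !handshake leq_double.
by apply.
Qed.

End Graphs.

(** * Trees given by a parent function *)

Definition nbr_of (V : eqType) (rt : V) (par : V -> V) : rel V :=
  fun u v => ((u != rt) && (v == par u)) || ((v != rt) && (u == par v)).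

Lemma nbr_of_sym (V : eqType) (rt : V) (par : V -> V) : symmetric (nbr_of rt par).
Proof. by move=> u v; rewrite /nbr_of orbC. Qed.

Section ParentTree.
Variables (n : nat) (rt : 'I_n) (par : 'I_n -> 'I_n) (rank : 'I_n -> nat).
Hypothesis rankP : forall v, v != rt -> rank (par v) < rank v.

Definition tree_of : {set Kedge n} :=
  [set e | [exists u, exists v, nbr_of rt par u v && (val e == [set u; v])]].

Lemma nbr_of_irr u v : nbr_of rt par u v -> u != v.
Proof.
by case/orP=> /andP [/rankP lt /eqP e]; apply/eqP=> uv; move: lt; rewrite -e uv ltnn.
Qed.

Lemma adjT_tree_of u v : adjT tree_of u v = nbr_of rt par u v.
Proof.
apply/adjTP/idP => [[uv]|uv].
  rewrite inE => /existsP [x /existsP [y /andP [xy /eqP /= e]]].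
  have := set21 u v; have := set22 u v; rewrite e !inE.
  by case/pred2P=> ev /pred2P [] eu; move: uv; rewrite eu ev ?eqxx // nbr_of_sym.
exists (nbr_of_irr uv); rewrite inE; apply/existsP; exists u; apply/existsP; exists v.
by rewrite uv /=.
Qed.

Lemma tree_of_connected : connectedT tree_of.
Proof.
have csym : connect_sym (adjT tree_of) by apply: sym_connect_sym => u v; rewrite !adjT_tree_of nbr_of_sym.
have croot v : connect (adjT tree_of) v rt.
  have [m] := ubnP (rank v); elim: m v => // m IH v; rewrite ltnS => lem.
  have [->|vr] := eqVneq v rt; first exact: connect0.
  apply: (@connect_trans _ _ (par v)); last exact/IH/(leq_trans (rankP vr)).
  by apply: connect1; rewrite adjT_tree_of /nbr_of vr eqxx.
by move=> u v; apply: connect_trans (croot u) _; rewrite csym.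
Qed.

(* A highest-ranked vertex of a cycle would have two distinct parents. *)
Lemma tree_of_acyclic : acyclicT tree_of.
Proof.
move=> p up sp; apply/negP=> cyc.
case: p => // x0 p0 in up sp cyc.
have [v vp vmax] : exists2 v, v \in x0 :: p0 & forall u, u \in x0 :: p0 -> rank u <= rank v.
  case: (arg_maxnP (fun u => rank u) (mem_head x0 p0 : x0 \in pred_of_seq (x0 :: p0))) => v vp vmax.
  by exists v.
case: (rot_to vp) => i q rq.
have : cycle (adjT tree_of) (v :: q) by rewrite -rq rot_cycle.
have : uniq (v :: q) by rewrite -rq rot_uniq.
have : 2 < size (v :: q) by rewrite -rq size_rot.
have qmax u : u \in v :: q -> rank u <= rank v.
  by rewrite -rq mem_rot; apply: vmax.
case: q qmax rq => [|a q] //; case: (lastP q) => [|{}q b] // qmax _ _.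
move=> /= /and3P [_ auq _]; rewrite !rcons_path last_rcons => /andP [va /andP [_ bv]].
have parof u : u \in v :: a :: rcons q b -> adjT tree_of v u -> u = par v.
  move=> /qmax le; rewrite adjT_tree_of => /orP [/andP [_ /eqP //]|/andP [/rankP lt /eqP e]].
  by move: lt; rewrite -e ltnNge le.
have ea : a = par v by apply: parof va; rewrite !inE eqxx orbT.
have eb : b = par v.
  by apply: parof; rewrite ?(adjT_sym _ v) // !inE mem_rcons inE eqxx !orbT.
by move: auq; rewrite ea -eb mem_rcons mem_head.
Qed.

Lemma card_tree_of : #|tree_of| < n.
Proof.
have n0 : 0 < n by apply: leq_ltn_trans (ltn_ord rt).
rewrite -(card_imset _ val_inj).
apply: (@leq_ltn_trans #|[set [set v; par v] | v in [set~ rt]]|).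
  apply: subset_leq_card; apply/subsetP=> _ /imsetP [e eT ->].
  move: eT; rewrite inE => /existsP [u /existsP [v /andP [/orP [] /andP [nr /eqP ->] /eqP ->]]].
    by apply: imset_f; rewrite !inE.
  by rewrite setUC; apply: imset_f; rewrite !inE.
apply: leq_ltn_trans (leq_imset_card _ _) _.
by rewrite cardsC1 card_ord prednK.
Qed.
End ParentTree.

(** * The switch network *)

(** Turns an equality of degrees into one of counts over the few vertices where two neighbourhoods
    may differ. *)
Lemma count_agree (T : finType) (X Y : {pred T}) (l : seq T) : uniq l ->
  (forall u, u \notin l -> (u \in X) = (u \in Y)) -> #|X| = #|Y| ->
  count (mem X) l = count (mem Y) l.
Proof.
move=> ul agree; have split_card (Z : {pred T}) :
    #|Z| = count (mem Z) l + #|[predD Z & mem l]|.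
  rewrite -(cardID (mem l) Z); congr (_ + _); rewrite -size_filter.
  have /card_uniqP <- := filter_uniq (mem Z) ul.
  by apply: eq_card => u; rewrite !inE mem_filter.
rewrite [#|X|]split_card [#|Y|]split_card.
rewrite (_ : #|[predD X & mem l]| = #|[predD Y & mem l]|); first exact: addIn.
by apply: eq_card => u; rewrite !inE; case: (boolP (u \in l)) => //= /agree.
Qed.

Section Gadget.
(** [pc] and [nc] are predecessor and successor in a chain of cells from [fc] to [lc]. The tags
    [None], [Some false], [Some true] stand for the first, second and third switch of a cell.
    [at_ w y] is the switch on which the link [w] lies in state [y], [itm] is the partial inverse,
    and [mu] grows along each link. *)
Variables (C : finType) (pc nc : C -> option C) (fc lc : C) (rk : C -> nat).
Local Notation S := (C * option bool)%type.
Variables (It : finType) (at_ : It -> bool -> S) (itm : S -> bool -> option It).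
Variables (mu : S -> nat) (p t : nat).

Hypothesis pcnc : forall c d, pc d = Some c <-> nc c = Some d.
Hypothesis pcN : forall d, pc d = None <-> d = fc.
Hypothesis ncN : forall c, nc c = None <-> c = lc.
Hypothesis rkP : forall c d, pc d = Some c -> rk c < rk d.
Hypothesis itmP : forall s y w, itm s y = Some w <-> at_ w y = s.
Hypothesis muP : forall w, mu (at_ w false) < mu (at_ w true).

Definition core : finType := (S * (bool * bool) + It)%type.
Definition vtx : finType := (core + core * 'I_p + 'I_t.+2)%type.

(* [kL s b] and [kR s b] are the ends of strand [b] on the two sides of the
   switch [s], [kI w] is a link vertex; [tail ord0] is the start of the path. *)
Definition K (v : core) : vtx := inl (inl v).
Definition kL (s : S) (b : bool) : core := inl (s, (false, b)).
Definition kR (s : S) (b : bool) : core := inl (s, (true, b)).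
Definition kI (w : It) : core := inr w.
Definition leaf (v : core) (i : 'I_p) : vtx := inl (inr (v, i)).
Definition tail (j : 'I_t.+2) : vtx := inr j.
Definition root := tail ord0.

(* In state [y] the strand leaving [kL s false] reaches [kR s y], through the
   link vertex [itm s y] if there is one; [feed] and [exit] are the neighbours
   of these two vertices along it. *)
Definition feed s y : core := if itm s y is Some w then kI w else kL s false.
Definition exit s y : core := if itm s y is Some w then kI w else kR s y.

Definition parL (s : S) (b : bool) : vtx :=
  match s.2 with
  | None => if b then K (kR (s.1, Some true) false)
            else if pc s.1 is Some d then K (kR (d, Some true) true) else root
  | Some false => K (kR (s.1, None) b)
  | Some true => K (kR (s.1, Some false) b)
  end.

Definition state := S -> bool.
Definition loc (c : state) w := at_ w (c (at_ w false)).

Definition parK (c : state) (v : core) : vtx :=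
  match v with
  | inl (s, (false, b)) => parL s b
  | inl (s, (true, b)) => K (if b == c s then feed s b else kL s true)
  | inr w => K (kL (loc c w) false)
  end.

(** The surplus vertices prolong the path past the last cell. There is at least one besides the
    root, so that the last core vertex has a successor. *)
Definition parT (j : 'I_t.+2) : vtx :=
  match val j with
  | 0 => root
  | 1 => K (kR (lc, Some true) true)
  | j'.+1 => tail (inord j')
  end.

Definition par (c : state) (v : vtx) : vtx :=
  match v with
  | inl (inl v) => parK c v
  | inl (inr (v, _)) => K v
  | inr j => parT j
  end.

Definition coherent (c : state) := forall w, c (at_ w false) = c (at_ w true).
Definition parity (c : state) i := c (i, None) (+) c (i, Some false) (+) c (i, Some true).

(* [pre c s] tells whether the strands are exchanged on arrival at [s], so that
   [pass] is the number of the traversal of the cell on which a vertex is met. *)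
Definition pre (c : state) (s : S) : bool :=
  match s.2 with
  | None => false
  | Some false => c (s.1, None)
  | Some true => c (s.1, None) (+) c (s.1, Some false)
  end.

Definition pass (c : state) (v : core) : bool :=
  match v with
  | inl (s, (false, b)) => b (+) pre c s
  | inl (s, (true, b)) => b (+) pre c s (+) c s
  | inr w => pre c (loc c w)
  end.

Definition swi (c : state) (v : core) : S :=
  match v with inl (s, _) => s | inr w => loc c w end.

Definition num (o : option bool) : nat := if o is Some b then b.+1 else 0.
Definition kind (v : core) : nat := match v with inl (_, (b, _)) => b.*2 | inr _ => 1 end.

(* Position on the path: 12 slots per traversal of a cell, 4 per switch. *)
Definition rankK c (v : core) : nat :=
  (24 * rk (swi c v).1 + 12 * pass c v + 4 * num (swi c v).2 + kind v).+1.

Definition rank c (v : vtx) : nat :=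
  match v with
  | inl (inl v) => rankK c v
  | inl (inr (v, _)) => (rankK c v).+1
  | inr j => if val j is j'.+1 then rankK c (kR (lc, Some true) true) + j'.+1 else 0
  end.

Lemma coherentE c w y : coherent c -> c (at_ w y) = c (at_ w false).
Proof. by move=> coh; case: y; rewrite ?coh. Qed.

Lemma itm_loc c s w : coherent c -> itm s (c s) = Some w -> loc c w = s.
Proof. by move=> coh /itmP e; rewrite /loc -(coherentE w (c s) coh) !e. Qed.

Lemma loc_itm c s w : coherent c -> loc c w = s -> itm s (c s) = Some w.
Proof.
by move=> coh e; apply/itmP; rewrite -[in LHS]e [c _](coherentE _ _ coh).
Qed.

(** Even parity puts the end of strand [false] of a cell on the first traversal and that of strand
    [true] on the second, as the feedback edge and the edge to the next cell require. *)
Lemma rank_par c v : coherent c -> (forall i, parity c i = false) ->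
  v != root -> rank c (par c v) < rank c v.
Proof.
move=> coh ev; case: v => [[[[s [b y]]|w]|[v i]]|j].
- move=> _; case: b => /=.
    have [ey|ny] := eqVneq y (c s).
      rewrite /feed; case E: (itm s y) => [w|]; rewrite /rankK /=.
        rewrite ey in E *; rewrite (itm_loc coh E).
        by case: (c s) (pre c s) => [] [] /=; lia.
      by rewrite ey; case: (c s) (pre c s) => [] [] /=; lia.
    rewrite /rankK /=.
    by move: ny; case: (c s) y (pre c s) => [] [] [] //=; lia.
  case: s => i [[]|]; rewrite /parL /=.
  + rewrite /= /rankK /= /pre /=.
    by case: (c (i, None)) (c (i, Some false)) y => [] [] [] /=; lia.
  + by rewrite /= /rankK /= /pre /=; case: (c _) y => [] [] //=; lia.
  case: y.
    rewrite /= /rankK /= /pre /=.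
    move: (ev i); rewrite /parity; case: (c (i, None)) (c (i, Some false)) (c (i, Some true)) => [] [] [] //=; lia.
  case E: (pc i) => [d|] //; rewrite /= /rankK /= /pre /=.
  move: (rkP E) (ev d); rewrite /parity.
  by case: (c (d, None)) (c (d, Some false)) (c (d, Some true)) => [] [] [] //=; lia.
- by move=> _ /=; rewrite /rankK /=; case: (pre _ _); lia.
- by move=> _ /=.
case: j => [[|[|j]] jP] // _; rewrite /= ?addn1 // inordK ?addnS //; lia.
Qed.

Definition loopK c i (v : core) := ((swi c v).1 == i) && pass c v.

Definition loop c i : {set vtx} :=
  [set v | match v with
           | inl (inl v) => loopK c i v
           | inl (inr (v, _)) => loopK c i v
           | inr _ => false
           end].

(* In a cell of odd parity the strand through [kL (i, None) true] closes up. *)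
Lemma loop_par c i v : coherent c -> parity c i ->
  v != root -> (par c v \in loop c i) = (v \in loop c i).
Proof.
move=> coh; rewrite /parity => od; case: v => [[[[s [b y]]|w]|[v l]]|j].
- move=> _; case: b; rewrite !inE /=.
    have [ey|ny] := eqVneq y (c s).
      rewrite /feed; case E: (itm s y) => [w|]; rewrite /loopK /= ey.
        rewrite ey in E; rewrite (itm_loc coh E).
        by case: (c s) (pre c s) => [] [].
      by case: (c s) (pre c s) => [] [].
    by rewrite /loopK /=; move: ny; case: (c s) y (pre c s) => [] [] [].
  case: s => k [[]|]; rewrite /parL /= /loopK /= /pre /= ?addbA //.
    by rewrite addbAC -!addbA; case: (c (k, None)) (c (k, Some false)) y => [] [] [].
  case: y; rewrite /loopK /pre /=.
    by case: eqP => // ->; rewrite od.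
  rewrite andbF; case E: (pc k) => [d|] //=; rewrite /loopK /= /pre /=.
  by case: eqP => //= ->; rewrite addNb od.
- by rewrite !inE /= /loopK.
- by rewrite !inE.
case: j => [[|[|j]] jP] // _; rewrite !inE //= /loopK /= /pre /=.
by case: eqP => //= ->; rewrite addNb od.
Qed.

(** * Neighbourhoods and degrees in the network *)

Local Notation nbr c := (nbr_of root (par c)).

(* The neighbours of [v] that depend on the state. *)
Definition switched (v : vtx) : seq vtx :=
  match v with
  | inl (inl (inl (s, (false, false)))) => [:: K (exit s false); K (exit s true)]
  | inl (inl (inl (s, (false, true)))) => [:: K (kR s false); K (kR s true)]
  | inl (inl (inl (s, (true, b)))) => [:: K (feed s b); K (kL s true)]
  | inl (inl (inr w)) =>
      [:: K (kL (at_ w false) false); K (kR (at_ w false) false);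
          K (kL (at_ w true) false); K (kR (at_ w true) true)]
  | _ => [::]
  end.

Lemma at_neq w : at_ w false != at_ w true.
Proof. by apply/eqP=> e; move: (muP w); rewrite e ltnn. Qed.

Lemma uniq_switched v : uniq (switched v).
Proof.
case: v => [[[[s [[] y]]|w]|[v l]]|j] //=.
- by rewrite andbT inE /feed; case: (itm s y) => [w|]; apply/eqP => - [].
- case: y; rewrite /= andbT inE; first by apply/eqP=> -[].
  rewrite /exit; case E: (itm s false) => [w|]; case E': (itm s true) => [w'|];
    apply/eqP => -[] // ew; subst w'.
  by move/itmP: E; move/itmP: E' => <- /eqP; apply/negP/at_neq.
rewrite !inE !negb_or andbT -!andbA.
by rewrite /= at_neq /=; do ?(apply/andP; split); apply/eqP => -[].
Qed.

Lemma itm_at w y : itm (at_ w y) y = Some w.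
Proof. exact/itmP. Qed.

(** Only edges at a switch or a link vertex depend on the state, and the two ends of such an edge
    list each other in [switched]. *)
Lemma nbr_agree a b v u : coherent a -> coherent b ->
  u \notin switched v -> nbr a v u -> nbr b v u.
Proof.
move=> cohA cohB uv /orP [] /andP [nr /eqP e].
  rewrite /nbr_of nr /=; move: uv; rewrite e => uv; apply/orP; left; apply/eqP.
  case: v {nr e} uv => [[[[s [[] y]]|w]|[v l]]|j] //=.
    by rewrite !inE negb_or; case: (y == a s); rewrite !eqxx ?andbF.
  by rewrite !inE /loc; case: (a _); rewrite !eqxx ?orbT.
rewrite /nbr_of nr /=; move: uv; rewrite e => uv; apply/orP; right; apply/eqP.
case: u {nr e} uv => [[[[s [[] y]]|w]|[v' l]]|j] //=.
  case: (y == a s).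
    rewrite /feed; case E: (itm s y) => [w|] /=; rewrite !inE.
      by move/itmP: E => <-; case: y; rewrite !eqxx ?orbT.
    by rewrite /exit; case: y E => ->; rewrite !eqxx ?orbT.
  by rewrite !inE; case: y; rewrite eqxx ?orbT.
by rewrite /loc /exit; case: (a _); rewrite !inE itm_at eqxx ?orbT.
Qed.

Lemma exit_at w y : exit (at_ w y) y = kI w.
Proof. by rewrite /exit itm_at. Qed.

Lemma feed_at w y : feed (at_ w y) y = kI w.
Proof. by rewrite /feed itm_at. Qed.

Lemma loc_eq c s y w : coherent c -> itm s y = Some w -> (s == loc c w) = (y == c s).
Proof.
move=> coh E; apply/eqP/eqP => [e|e]; last first.
  by rewrite e in E; rewrite (itm_loc coh E).
have /itmP e1 := loc_itm coh (esym e); move/itmP: E => e2.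
move: e1; rewrite -[in RHS]e2; move: (at_neq w).
by move/eqP=> ne e3; case: y e2 e3; case: (c s) => // _ e3; case: ne; rewrite e3.
Qed.

Lemma K_inj : injective K. Proof. by move=> ? ? []. Qed.

Lemma parL_kI w s b : (K (kI w) == parL s b) = false.
Proof.
by case: s b => i [[]|] []; rewrite /parL //=; try case: (pc i) => [d|]; apply/eqP => -[].
Qed.

Lemma parL_kR s y b : (K (kR s y) == parL s b) = false.
Proof.
by case: s b => i [[]|] []; rewrite /parL //=; try case: (pc i) => [d|]; apply/eqP => -[].
Qed.

(** This and the next four lemmas evaluate the edges named in [switched] in terms of the state. *)
Lemma nbr_kL_exit c s y : coherent c ->
  nbr c (K (kL s false)) (K (exit s y)) = (y == c s).
Proof.
move=> coh; rewrite /nbr_of /exit /=; case E: (itm s y) => [w|] /=.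
  by rewrite parL_kI /= -(loc_eq coh E); apply/eqP/eqP => [[]|->].
rewrite parL_kR /=.
have [ey|ny] := eqVneq y (c s); first by rewrite /feed E eqxx.
by apply/eqP => -[].
Qed.

Lemma nbr_kL_kR c s y : nbr c (K (kL s true)) (K (kR s y)) = (y != c s).
Proof.
rewrite /nbr_of /=.
rewrite parL_kR /=.
have [ey|ny] := eqVneq y (c s); last by rewrite eqxx.
by rewrite /feed; case: (itm s y) => [w|]; apply/eqP => -[].
Qed.

Lemma nbr_kR_feed c s y : coherent c ->
  nbr c (K (kR s y)) (K (feed s y)) = (y == c s).
Proof.
move=> coh; rewrite /nbr_of /feed /=; case E: (itm s y) => [w|] /=.
  have [ey|ny] := eqVneq y (c s); first by rewrite /feed E eqxx.
  by apply/norP; split; apply/eqP => -[].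
have [ey|ny] := eqVneq y (c s); first by rewrite /feed E eqxx.
rewrite parL_kR orbF.
by apply/eqP => -[].
Qed.

Lemma nbr_kI_kL c w y : coherent c ->
  nbr c (K (kI w)) (K (kL (at_ w y) false)) = (y == c (at_ w y)).
Proof. by move=> coh; rewrite nbr_of_sym -(exit_at w y) nbr_kL_exit. Qed.

Lemma nbr_kI_kR c w y : coherent c ->
  nbr c (K (kI w)) (K (kR (at_ w y) y)) = (y == c (at_ w y)).
Proof. by move=> coh; rewrite nbr_of_sym -(feed_at w y) nbr_kR_feed. Qed.

(** [chR] and [chK] give the successor on the path, inverse to [par]; the last cell is followed by
    vertex 1 of the tail. *)
Definition chR (s : S) (b : bool) : vtx :=
  match s.2 with
  | None => K (kL (s.1, Some false) b)
  | Some false => K (kL (s.1, Some true) b)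
  | Some true =>
      if b then (if nc s.1 is Some d then K (kL (d, None) false) else tail (inord 1))
      else K (kL (s.1, None) true)
  end.

Definition chK (c : state) (v : core) : vtx :=
  match v with
  | inl (s, (true, b)) => chR s b
  | inl (s, (false, b)) => K (if b then kR s (~~ c s) else exit s (c s))
  | inr w => K (kR (loc c w) (c (at_ w false)))
  end.

Lemma parK_chK c v : coherent c -> (chK c v != root) && (par c (chK c v) == K v).
Proof.
move=> coh; case: v => [[[i o] [b y]]|w] /=; last first.
  rewrite /loc coherentE // eqxx /feed.
  by rewrite itm_at.
case: b; last first.
  case: y => /=; last first.
    rewrite /exit; case E: (itm _ _) => [w|] /=; last by rewrite eqxx /feed E.
    by rewrite (itm_loc coh E).
  by case: (c _) => /=.
case: o => [[]|] //=; case: y => //=.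
rewrite /chR /=; case E: (nc i) => [d|] /=; first by move/pcnc: E; rewrite /parL /= => ->.
rewrite /parT /= inordK //; move/ncN: E => ->; rewrite eqxx andbT; apply/eqP => -[] /(congr1 val); by rewrite /= inordK.
Qed.

Lemma chP c v u : coherent c -> u != root -> par c u = K v ->
  u = chK c v \/ exists l, u = leaf v l.
Proof.
move=> coh; case: u => [[[[s [b y]]|w]|[v' l]]|j] /=.
- move=> _; case: b => /=.
    have [-> /K_inj <-|ny /K_inj <-] := eqVneq y (c s); left.
      rewrite /feed; case E: (itm s (c s)) => [w|] /=; last by rewrite /exit E.
      have := itm_loc coh E; rewrite /loc => e.
      by rewrite /loc e -[in RHS](coherentE w (c (at_ w false)) coh) e.
    by rewrite /=; move: ny; case: y; case: (c s).
  case: s => i [[]|]; rewrite /parL /=.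
  + by move/K_inj <-; left.
  + by move/K_inj <-; left.
  case: y; first by move/K_inj <-; left.
  by case E: (pc i) => [d|] // /K_inj <-; left; move/pcnc: E => E; rewrite /= /chR /= E.
- by move=> _ /K_inj <-; left; rewrite /= /loc coherentE // exit_at.
- by move=> _ /K_inj ->; right; exists l.
case: j => [[|[|j]] jP] //= _ => /K_inj <-; left; rewrite /= /chR /=.
have /ncN -> := erefl lc; congr (tail _); apply: val_inj; by by rewrite /= inordK.
Qed.

(** The neighbours are the parent, the successor and the [p] leaves; the rank keeps parent and
    successor apart. *)
Lemma card_nbr_core c v : coherent c -> (forall i, parity c i = false) ->
  #|nbr c (K v)| = p.+2.
Proof.
move=> coh ev; have /andP [chr /eqP pch] := parK_chK v coh.
have rk1 := rank_par coh ev (isT : K v != root).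
have rk2 := rank_par coh ev chr; rewrite pch in rk2.
rewrite (@eq_card _ _ (par c (K v) |: (chK c v |: [set leaf v l | l : 'I_p]))).
  rewrite !cardsU1 !inE card_imset; last by move=> ? ? [].
  rewrite card_ord (_ : chK c v \notin _); last first.
    apply/imsetP => -[l _ e]; move: e; case: v {chr pch rk1 rk2} => [[[i [[]|]] [[] []]]|w] //=; rewrite /chR //=.
    by case: (nc i).
  rewrite (_ : _ == _ = false) /=; last first.
    by apply/eqP=> e; move: rk2; rewrite -e ltnNge ltnW.
  rewrite (_ : par c (K v) \notin _) //.
  by apply/imsetP=> -[l _ e]; move: rk1; rewrite e /= ltnNge leqW // leqnSn.
move=> u; rewrite !inE [LHS]unfold_in /nbr_of; apply/idP/idP.
  case/orP=> [/andP [_ ->] //|/andP [ur /eqP e]].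
  case: (chP coh ur (esym e)) => [->|[l ->]]; first by rewrite eqxx orbT.
  by rewrite imset_f ?orbT.
case/or3P=> [/eqP ->|/eqP ->|/imsetP [l _ ->]]; first by rewrite eqxx.
  by rewrite chr pch eqxx orbT.
by rewrite /= eqxx orbT.
Qed.

Definition is_core (v : vtx) : bool := if v is inl (inl _) then true else false.

Lemma card_nbr_outer c v : ~~ is_core v -> #|nbr c v| <= 2.
Proof.
case: v => [[v|[v l]]|j] // _.
  apply: (@leq_trans #|[set K v]|); last by rewrite cards1.
  apply: subset_leq_card; apply/subsetP=> u; rewrite !inE /nbr_of.
  case/orP=> /andP [_ /eqP e]; first by rewrite e /=.
  case: u e => [[[[s [[] y]]|w]|[v' l']]|j] //=.
    by case: s => i [[]|]; rewrite /parL //=; case: y => //; case: (pc i).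
  by case: j => [[|[|j]] jP].
(* The only possible child. At the last tail vertex [inord] falls back on a default, harmless for an
   upper bound. *)
pose nx := if val j == 0 then K (kL (fc, None) false) else tail (inord j.+1).
apply: (@leq_trans #|[set parT j; nx]|); last by rewrite cards2; case: (_ != _).
apply: subset_leq_card; apply/subsetP=> u; rewrite !inE /nbr_of.
case/orP=> /andP [nr /eqP e]; first by rewrite e eqxx.
apply/orP; right; apply/eqP; rewrite /nx; move: nr e.
case: u => [[[[s [[] y]]|w]|[v' l']]|j'] //=.
  case: s => i [[]|] _; rewrite /parL //=; case: y => //.
  by case E: (pc i) => [d|] // [->]; move/pcN: E => ->.
case: j' => [[|[|j']] jP] //= _ [->]; rewrite inordK //=; last exact: ltnW.
by congr inr; apply: val_inj; by rewrite /= inordK.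
Qed.

(** * Trees between the trees of two states *)

Section Between.
Variables (a b : state) (tr : rel vtx).
Hypotheses (cohA : coherent a) (cohB : coherent b) (tr_sym : symmetric tr).
Hypothesis tr_sub : forall u v, tr u v -> nbr a u v || nbr b u v.
Hypothesis tr_sup : forall u v, nbr a u v -> nbr b u v -> tr u v.
Hypothesis tr_deg : forall v, #|tr (K v)| = #|nbr a (K v)|.
Hypothesis tr_conn : forall (U : {set vtx}) u v,
  (forall x y, tr x y -> x \in U -> y \in U) -> u \in U -> v \in U.

Lemma tr_agree v u : u \notin switched v -> tr v u = nbr a v u.
Proof.
move=> uv; apply/idP/idP => [/tr_sub /orP [] //|na]; first exact: nbr_agree uv.
by apply: tr_sup => //; apply: nbr_agree uv na.
Qed.

(** Degrees agree, and so do the edges off the list; each list thus yields a Boolean relation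
    between the edges of [tr] at [v]. *)
Lemma tr_count v :
  count (tr (K v)) (switched (K v)) = count (nbr a (K v)) (switched (K v)).
Proof.
by apply: count_agree (uniq_switched _) _ (tr_deg v) => u; apply: tr_agree.
Qed.

Lemma tr_exit_neg s : tr (K (kL s false)) (K (exit s false)) =
  ~~ tr (K (kL s false)) (K (exit s true)).
Proof.
have := tr_count (kL s false); rewrite /= !nbr_kL_exit //.
by case: (a s) (tr _ _) (tr _ _) => [] [] [].
Qed.

(** The strand from [kL s true] carries no link vertex, so its edge shows the state directly: it
    reaches [kR s false] when the strands cross. *)
Definition between_state : state := fun s => tr (K (kL s true)) (K (kR s false)).
Local Notation c := between_state.

Lemma tr_kL_kR s y : tr (K (kL s true)) (K (kR s y)) = (y != c s).
Proof.
case: y; last by rewrite /c; case: (tr _ _).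
have := tr_count (kL s true); rewrite /= !nbr_kL_kR /c.
by case: (a s) (tr _ _) (tr _ _) => [] [] [].
Qed.

Lemma tr_feed s y : tr (K (kR s y)) (K (feed s y)) = (y == c s).
Proof.
have := tr_count (kR s y); rewrite /= nbr_kR_feed // nbr_of_sym nbr_kL_kR.
rewrite [tr _ (K (kL _ _))]tr_sym tr_kL_kR.
by case: (tr _ _) (y == c s) (y == a s) => [] [] [].
Qed.

Lemma tr_kI_kR w y : tr (K (kI w)) (K (kR (at_ w y) y)) = (y == c (at_ w y)).
Proof. by rewrite tr_sym -(feed_at w y) tr_feed. Qed.

(* Induction along the chain of link vertices: the first switch has no link on
   its crossed strand, and a link vertex has degree two, so that it transmits
   the state of one switch to the next. *)
Lemma tr_exit s y : tr (K (kL s false)) (K (exit s y)) = (y == c s).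
Proof.
suff H : tr (K (kL s false)) (K (exit s true)) = c s.
  by case: y; rewrite ?tr_exit_neg H; case: (c s).
have [m] := ubnP (mu s); elim: m s => // m IH s; rewrite ltnS => lem.
case E: (itm s true) => [w|]; last first.
  (* Without a link, [exit] and [feed] name the two ends of one edge. *)
  have := tr_feed s true; rewrite /feed /exit E tr_sym => ->.
  by case: (c s).
move/itmP: (E) => es; have := tr_count (kI w).
rewrite /= !nbr_kI_kL // !nbr_kI_kR // !tr_kI_kR cohA es.
rewrite /exit E [tr _ (K (kL s false))]tr_sym.
have := IH (at_ w false); rewrite -{1}es => /(_ _) H.
have {}H : tr (K (kL (at_ w false) false)) (K (kI w)) = ~~ c (at_ w false).
  rewrite -(exit_at w false) tr_exit_neg H //.
  by apply: leq_trans lem; rewrite -es muP.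
rewrite [tr _ (K (kL (at_ w false) false))]tr_sym H.
by rewrite ?es; case: (a s) (c s) (c (at_ w false)) (tr _ _) => [] [] [] [].
Qed.

(** The switched edges at [w] now occur in pairs, one pair per switch, and degree two admits exactly
    one pair. *)
Lemma between_coherent : coherent c.
Proof.
move=> w; have := tr_count (kI w).
rewrite /= !nbr_kI_kL // !nbr_kI_kR // !tr_kI_kR ![tr _ (K (kL _ _))]tr_sym.
rewrite -(exit_at w false) tr_exit exit_at -(exit_at w true) tr_exit cohA.
by case: (a _) (c _) (c _) => [] [] [].
Qed.

(** An edge of [tr] is a parent edge for [a] or [b]; where parents depend on the state, its presence
    reveals that this state is [c]. *)
Lemma tr_nbr u v : tr u v -> nbr c u v.
Proof.
suff H x y : tr x y -> x != root -> y = par a x \/ y = par b x -> y = par c x.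
  move=> uv; case/orP: (tr_sub uv) => /orP [] /andP [nr /eqP e]; rewrite /nbr_of nr /=.
  - by rewrite -(H u v) ?eqxx //; left.
  - by rewrite -(H v u) ?eqxx ?orbT 1?tr_sym //; left.
  - by rewrite -(H u v) ?eqxx //; right.
  - by rewrite -(H v u) ?eqxx ?orbT 1?tr_sym //; right.
move=> xy nr e.
have {e} [d e] : exists d, y = par d x by case: e => e; [exists a|exists b].
subst y; case: x xy nr => [[[[s [[] y]]|w]|[v' l]]|j] //=.
  move=> xy _; congr K; move: xy; case: (y == d s).
    by rewrite tr_feed => ->.
  by rewrite tr_sym tr_kL_kR => /negbTE ->.
rewrite /loc => xy _; congr (K (kL (at_ w _) _)).
move: xy; have := tr_exit (at_ w (d (at_ w false))) (d (at_ w false)).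
rewrite exit_at tr_sym => -> /eqP {1}->.
by rewrite coherentE //; apply: between_coherent.
Qed.

(** In an odd cell the second traversal would be closed under [tr] without containing the root,
    against connectedness. *)
Lemma between_parity i : parity c i = false.
Proof.
apply/negP => od.
have clo x y : tr x y -> x \in loop c i -> y \in loop c i.
  move/tr_nbr/orP => [] /andP [nr /eqP ->]; rewrite loop_par //; exact: between_coherent.
have : root \in loop c i.
  apply: tr_conn clo (_ : K (kL (i, None) true) \in _).
  by rewrite inE /loopK /= eqxx.
by rewrite inE.
Qed.

Lemma between_agree s : a s = b s -> c s = a s.
Proof.
move=> ab; have := tr_kL_kR s (~~ a s); rewrite tr_sup ?nbr_kL_kR -?ab ?eqb_negLR ?negbK //.
- by case: (a s) (c s) => [] [].
- by case: (a s).
- by case: (a s).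
Qed.
End Between.

Lemma nbr_ext c d : c =1 d -> nbr c =2 nbr d.
Proof.
move=> cd u v; have parE x : par c x = par d x.
  by case: x => [[[[s [[] y]]|w]|[v' l]]|j] //=; rewrite /loc cd.
by rewrite /nbr_of !parE.
Qed.

(** * The network as a subgraph of the complete graph *)

Section Embed.
Variable n : nat.
Hypothesis card_vtx : #|vtx| = n.

Definition emb (v : vtx) : 'I_n := cast_ord card_vtx (enum_rank v).
Definition proj (x : 'I_n) : vtx := enum_val (cast_ord (esym card_vtx) x).

Lemma embK : cancel emb proj.
Proof. by move=> v; rewrite /emb /proj cast_ordK enum_rankK. Qed.

Lemma projK : cancel proj emb.
Proof. by move=> v; rewrite /emb /proj enum_valK cast_ordKV. Qed.

Definition good (c : state) := coherent c /\ forall i, parity c i = false.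

Definition gtree c : {set Kedge n} :=
  tree_of (emb root) (fun x => emb (par c (proj x))).

Lemma emb_rank c : good c -> forall x, x != emb root ->
  rank c (proj (emb (par c (proj x)))) < rank c (proj x).
Proof.
move=> [coh ev] x xr; rewrite embK; apply: rank_par => //.
by apply: contra_neq xr => <-; rewrite projK.
Qed.

Lemma adjT_gtree c u v : good c -> adjT (gtree c) (emb u) (emb v) = nbr c u v.
Proof.
move=> gc; rewrite (adjT_tree_of (emb_rank gc)) /nbr_of !embK.
by rewrite !(can_eq embK).
Qed.

Lemma degT_emb T v : degT T (emb v) = #|[pred u | adjT T (emb v) (emb u)]|.
Proof.
rewrite degT_adjT -(card_imset _ (can_inj embK)); apply: eq_card => x.
rewrite inE; apply/idP/imsetP => [vx|[u uv ->]]; last exact: uv.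
by exists (proj x); rewrite ?inE projK.
Qed.

Lemma degT_gtree c v : good c -> degT (gtree c) (emb v) = #|nbr c v|.
Proof.
by move=> gc; rewrite degT_emb; apply: eq_card => u; rewrite inE adjT_gtree.
Qed.

Lemma gtree_dc c : good c -> dc_tree n p.+2 (gtree c).
Proof.
move=> gc; split; first split.
- exact: tree_of_connected (emb_rank gc).
- exact: tree_of_acyclic (emb_rank gc).
move=> x; rewrite -(projK x) degT_gtree //; case: gc => coh ev.
case E: (is_core (proj x)); last by apply: leq_trans (card_nbr_outer _ _) _; rewrite ?E.
by case: (proj x) E => // -[] // v _; rewrite card_nbr_core.
Qed.

Lemma gtree_inj c d : good c -> good d -> gtree c = gtree d -> c =1 d.
Proof.
move=> gc gd e s; have := adjT_gtree (K (kL s true)) (K (kR s false)) gc.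
rewrite e adjT_gtree // !nbr_kL_kR; by case: (c s) (d s) => [] [].
Qed.

Lemma gtree_between a b T : good a -> good b -> dc_tree n p.+2 T ->
  gtree a :&: gtree b \subset T -> T \subset gtree a :|: gtree b ->
  exists2 c, good c & (forall s, a s = b s -> c s = a s) /\
    forall d, good d -> c =1 d -> T = gtree d.
Proof.
move=> ga gb [[conT _] degk] sT Ts; have [cohA evA] := ga; have [cohB evB] := gb.
pose tr : rel vtx := fun u v => adjT T (emb u) (emb v).
have tr_sym : symmetric tr by move=> u v; apply: adjT_sym.
have tr_sub u v : tr u v -> nbr a u v || nbr b u v.
  rewrite -!adjT_gtree // => /adjTP [uv /(subsetP Ts)]; rewrite inE => /orP [] eT.
    by apply/orP; left; apply/adjTP; exists uv.
  by apply/orP; right; apply/adjTP; exists uv.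
have tr_sup u v : nbr a u v -> nbr b u v -> tr u v.
  rewrite -!adjT_gtree // => /adjTP [uv ea] /adjTP [uv' eb].
  apply/adjTP; exists uv; apply: (subsetP sT); rewrite inE ea /=.
  by rewrite (bool_irrelevance uv uv').
(* A connected graph has at least n - 1 edges, a parent tree at most that many. *)
have cardT d : good d -> #|gtree d| <= #|T|.
  move=> gd; rewrite -ltnS; apply: leq_trans (connectedT_card conT).
  exact: card_tree_of.
(* Core vertices of [gtree a] attain the degree bound; at the others [switched] is empty, so [T] has
   no edge there outside [gtree a]. *)
have degle x : degT T x <= degT (gtree a) x.
  case E: (is_core (proj x)).
    rewrite -(projK x); case: (proj x) E => // -[] // v _.
    rewrite degT_gtree // card_nbr_core //; exact: degk.
  rewrite -(projK x) degT_emb degT_gtree //; apply: subset_leq_card.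
  apply/subsetP=> u /tr_sub /orP [] // /(nbr_agree (b := a)) H.
  by apply: H => //; case: (proj x) E => [[]|].
have tr_deg v : #|tr (K v)| = #|nbr a (K v)|.
  rewrite -degT_gtree // -(degT_mono_eq (cardT _ ga) degle) degT_emb.
  by apply: eq_card => u; rewrite inE.
have tr_conn (U : {set vtx}) u v :
    (forall x y, tr x y -> x \in U -> y \in U) -> u \in U -> v \in U.
  move=> clo uU; have memE x : (x \in emb @: U) = (proj x \in U).
    by rewrite -{1}(projK x) mem_imset //; apply: can_inj embK.
  rewrite -(embK v) -memE; apply: (@connectedT_closed _ _ _ (emb u) _ conT).
    by move=> x y xy; rewrite !memE; apply: clo; rewrite /tr !projK.
  by rewrite memE embK.
pose c := between_state tr.
have cohC : coherent c by apply: (@between_coherent a b).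
exists c; first by split=> // i; apply: (@between_parity a b).
split=> [s|d gd cd]; first exact: (@between_agree a b).
(* As [gtree d] has no more edges than [T], one inclusion suffices. *)
apply/eqP; rewrite eqEcard cardT // andbT adjT_sub.
apply/forallP=> x; apply/forallP=> y; apply/implyP.
rewrite -(projK x) -(projK y) adjT_gtree // -(nbr_ext cd).
exact: (@tr_nbr a b).
Qed.
End Embed.
End Gadget.

(** * The triangular arrangement of cells *)

Lemma finite_chain (C : finType) : 0 < #|C| ->
  exists (pc nc : C -> option C) (fc lc : C) (rk : C -> nat),
    [/\ forall c d, pc d = Some c <-> nc c = Some d,
        forall d, pc d = None <-> d = fc,
        forall c, nc c = None <-> c = lc &
        forall c d, pc d = Some c -> rk c < rk d].
Proof.
move=> C0; pose rk (c : C) : nat := enum_rank c.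
have rkl c : rk c < #|C| by apply: ltn_ord.
have rk_inj : injective rk by move=> c d /val_inj /enum_rank_inj.
have rkv j (jC : j < #|C|) : rk (enum_val (Ordinal jC)) = j by rewrite /rk enum_valK.
pose at_rk j : option C := omap (@enum_val C predT) (insub j).
have at_rkP j c : at_rk j = Some c <-> rk c = j.
  rewrite /at_rk; case: insubP => [i iC ei|jC] /=.
    split=> [[<-]|e]; first by rewrite /rk enum_valK.
    by congr Some; apply: rk_inj; rewrite e /rk enum_valK.
  by split=> // e; move: jC; rewrite -e rkl.
have at_rkN j : at_rk j = None <-> #|C| <= j.
  by rewrite /at_rk; case: insubP => [i iC ei|jC] /=; split=> //; [rewrite leqNgt iC|rewrite leqNgt].
have lC : #|C|.-1 < #|C| by rewrite prednK.
exists (fun d => if rk d is j.+1 then at_rk j else None), (fun c => at_rk (rk c).+1).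
exists (enum_val (Ordinal C0)), (enum_val (Ordinal lC)), rk; split.
- move=> c d; rewrite at_rkP; case E: (rk d) => [|j] //; rewrite at_rkP.
  by split=> [->|[]].
- move=> d; case E: (rk d) => [|j].
    by split=> // _; apply: rk_inj; rewrite rkv.
  split=> [/at_rkN|e]; first by rewrite leqNgt -ltnS ltnW // -E ltnS rkl.
  by move: E; rewrite e rkv.
- move=> c; rewrite at_rkN; split=> [le|->]; last by rewrite rkv prednK.
  by apply: rk_inj; rewrite rkv; apply/eqP; rewrite eqn_leq -ltnS prednK // rkl -ltnS prednK.
move=> c d; case E: (rk d) => [|j] // /at_rkP ->; exact: ltnSn.
Qed.

Section Triangle.
Variable q : nat.

(** Diagonal cells tie bit i as first index to bit i as second index: their third switch is always
    off, so parity makes the first two agree. *)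
Definition cell : finType := {x : 'I_q * 'I_q | x.1 <= x.2}.
Definition link : finType := ({x : 'I_q * 'I_q | x.1 < x.2} * bool)%type.
Local Notation S := (cell * option bool)%type.

Definition mkcell (i j : 'I_q) (ij : i <= j) : cell := exist _ (i, j) ij.

Definition pred_ord (j : 'I_q) : 'I_q := Ordinal (leq_ltn_trans (leq_pred j) (ltn_ord j)).
Definition succ_below (i j : 'I_q) (ij : i < j) : 'I_q :=
  Ordinal (leq_ltn_trans ij (ltn_ord j)).

Lemma pred_ord_le (i j : 'I_q) : i < j -> i <= pred_ord j.
Proof. by case: j => [[|j] jq]. Qed.

(* The links at [i < j] join the first switches of the cells [(i, j - 1)] and
   [(i, j)], and the second switches of the cells [(i, j)] and [(i + 1, j)]. *)
Definition link_at (w : link) (y : bool) : S :=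
  let: (exist x ij, b) := w in
  if b then (if y then mkcell (ltnW ij) else mkcell (pred_ord_le ij), None)
  else (if y then @mkcell (succ_below ij) x.2 ij else mkcell (ltnW ij), Some false).

Definition switch_link (s : S) (y : bool) : option link :=
  [pick w | link_at w y == s].

Definition depth (s : S) : nat := (val s.1).1 + (val s.1).2.

Definition bits_state (a : 'I_q -> bool) (s : S) : bool :=
  let x := val s.1 in
  match s.2 with
  | None => a x.1
  | Some false => a x.2
  | Some true => a x.1 (+) a x.2
  end.

Lemma link_at_inj y : injective (fun w => link_at w y).
Proof.
move=> [[[i j] ij] b] [[[i' j'] ij'] b'] /=.
have link_eq : i = i' -> j = j' ->
    exist (fun x : 'I_q * 'I_q => x.1 < x.2) (i, j) ij = exist _ (i', j') ij'.
  by move=> ei ej; apply: val_inj; rewrite /= ei ej.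
case: b b' y => [] [] [] //= [] ei ej; congr (_, _); apply: link_eq => //.
  by apply: val_inj; move: ij ij' ej => /= ij ij' ej; lia.
exact: val_inj.
Qed.

Lemma switch_linkP s y w : switch_link s y = Some w <-> link_at w y = s.
Proof.
rewrite /switch_link; split=> [|<-].
  by case: pickP => // x /eqP <- [->].
by case: pickP => [x /eqP /link_at_inj -> //|/(_ w)]; rewrite eqxx.
Qed.

Lemma depth_link w : depth (link_at w false) < depth (link_at w true).
Proof. by case: w => [[[i j] /= ij] []]; rewrite /depth /=; lia. Qed.

Lemma bits_good a : good link_at (bits_state a).
Proof.
split=> [[[[i j] /= ij] []]|[[i j] ij]] //; rewrite /parity /bits_state /=.
by case: (a i) (a j) => [] [].
Qed.

Lemma coherent_row c (i j : 'I_q) (ij : i <= j) : coherent link_at c ->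
  c (mkcell ij, None) = c (mkcell (leqnn i), None).
Proof.
move=> coh; have [m] := ubnP (j : nat); elim: m j ij => // m IH j ij jm.
have [e|ne] := eqVneq i j.
  by congr (c (_, _)); apply: val_inj; rewrite /= e.
have lt : i < j by rewrite ltn_neqAle ne.
have := coh (exist _ (i, j) lt, true); rewrite /= => /esym e.
transitivity (c (mkcell (ltnW lt), None)).
  by congr (c (_, _)); apply: val_inj.
by rewrite e IH //= -ltnS prednK // (leq_ltn_trans _ lt).
Qed.

Lemma coherent_col c (i j : 'I_q) (ij : i <= j) : coherent link_at c ->
  c (mkcell ij, Some false) = c (mkcell (leqnn j), Some false).
Proof.
move=> coh; have [m] := ubnP (j - i); elim: m i ij => // m IH i ij jm.
have [e|ne] := eqVneq i j.
  by congr (c (_, _)); apply: val_inj; rewrite /= e.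
have lt : i < j by rewrite ltn_neqAle ne.
have := coh (exist _ (i, j) lt, false); rewrite /= => e.
transitivity (c (mkcell (ltnW lt), Some false)).
  by congr (c (_, _)); apply: val_inj.
by rewrite e IH //=; lia.
Qed.

Lemma bits_between a b c : good link_at c ->
  (forall s, bits_state a s = bits_state b s -> c s = bits_state a s) ->
  c =1 bits_state a \/ c =1 bits_state b.
Proof.
move=> [coh ev] agree; pose u (i : 'I_q) := c (mkcell (leqnn i), None).
have col (i j : 'I_q) (ij : i <= j) : c (mkcell ij, Some false) = u j.
  rewrite coherent_col //; have := ev (mkcell (leqnn j)); rewrite /parity.
  rewrite [c (_, Some true)]agree /bits_state /= ?addbb // addbF => /negbT.
  by rewrite -/(u j) negb_add => /eqP.
have row (i j : 'I_q) (ij : i <= j) : c (mkcell ij, None) = u i by rewrite coherent_row.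
have diag (i j : 'I_q) (ij : i <= j) : c (mkcell ij, Some true) = u i (+) u j.
  have := ev (mkcell ij); rewrite /parity row col.
  by case: (u i) (u j) (c _) => [] [] [].
have cu : c =1 bits_state u.
  case=> [[[i j] ij] o]; rewrite /bits_state /= -[exist _ _ _]/(mkcell ij).
  by case: o => [[]|]; rewrite ?diag ?row ?col.
have same i : a i = b i -> u i = a i by move=> e; apply: agree.
have differ_le (i j : 'I_q) : i <= j -> a i != b i -> a j != b j -> u i (+) u j = a i (+) a j.
  move=> ij nei nej; rewrite -(diag _ _ ij) agree //= /bits_state /=.
  by case: (a i) (b i) (a j) (b j) nei nej => [] [] [] [].
have differ i j : a i != b i -> a j != b j -> u i (+) u j = a i (+) a j.
  move=> nei nej; case/orP: (leq_total i j) => ij; first exact: differ_le.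
  by rewrite addbC [RHS]addbC; apply: differ_le.
have ext d : u =1 d -> c =1 bits_state d.
  by move=> ud [[[i j] ij] o]; rewrite cu /bits_state /= !ud.
case: (pickP (fun i => u i != a i)) => [i0 ne0|eqa]; last first.
  by left; apply: ext => i; apply/eqP; move: (eqa i) => /negbFE.
have nab0 : a i0 != b i0 by apply: contra_neq ne0; apply: same.
(* If [u] departs from [a] at [i0], then [differ] makes it depart wherever [a] and [b] differ. *)
right; apply: ext => i; have [e|ne] := eqVneq (a i) (b i); first by rewrite same.
have := differ i i0 ne nab0; move: ne nab0 ne0.
by case: (u i) (u i0) (a i) (b i) (a i0) => [] [] [] [] [] //; case: (b i0).
Qed.

Lemma bits_inj a b : bits_state a =1 bits_state b -> a =1 b.
Proof. by move=> e i; apply: (e (mkcell (leqnn i), None)). Qed.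

Lemma card_cell : #|cell| * 2 = q * q.+1.
Proof.
have -> : #|cell| = \sum_(x : 'I_q * 'I_q) (x.1 <= x.2).
  rewrite card_sig -sum1_card big_mkcond; apply: eq_bigr => x _.
  by rewrite inE; case: (x.1 <= x.2).
have swap : \sum_(x : 'I_q * 'I_q) (x.1 <= x.2) = \sum_(x : 'I_q * 'I_q) (x.2 <= x.1).
  rewrite -(pair_bigA _ (fun i j : 'I_q => (i <= j : nat))) exchange_big.
  by rewrite (pair_bigA _ (fun i j : 'I_q => (j <= i : nat))).
(* Both orders together count each pair once and the diagonal twice. *)
transitivity (\sum_(x : 'I_q * 'I_q) ((x.1 <= x.2) + (x.2 <= x.1))).
  by rewrite big_split /= -swap muln2 addnn.
transitivity (\sum_(x : 'I_q * 'I_q) (1 + (x.1 == x.2))).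
  by apply: eq_bigr => -[i j] _ /=; rewrite -val_eqE /=; case: ltngtP.
rewrite -(pair_bigA _ (fun i j : 'I_q => 1 + (i == j))) /=.
rewrite (eq_bigr (fun=> q.+1)) => [|i _]; first by rewrite sum_nat_const card_ord.
rewrite big_split /= sum1_card card_ord -addn1; congr (_ + _).
by rewrite (bigD1 i) //= eqxx big1 // => j; rewrite eq_sym => /negbTE ->.
Qed.

Lemma card_link : #|link| <= #|cell| * 2.
Proof.
rewrite card_prod card_bool leq_mul2r /= !card_sig subset_leq_card //.
by apply/subsetP=> x; rewrite !inE; apply: ltnW.
Qed.

(** A cell has 12 strand ends, and there are at most two links per cell: 14 vertices for each of q(q
    + 1)/2 cells. *)
Lemma card_core : #|core cell link| <= 7 * (q * q.+1).
Proof.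
rewrite card_sum !card_prod card_option card_bool -card_cell.
by have := card_link; rewrite card_prod card_bool; lia.
Qed.
End Triangle.

(** * Families of trees of the required size *)

Lemma between_family n p q : 0 < q -> 7 * (q * q.+1) * p.+1 + 2 <= n ->
  exists Q : {set {set Kedge n}},
    [/\ #|Q| = 2 ^ q,
        forall T, T \in Q -> dc_tree n p.+2 T &
        forall A B T, A \in Q -> B \in Q -> A != B -> dc_tree n p.+2 T ->
          A :&: B \subset T -> T \subset A :|: B -> T = A \/ T = B].
Proof.
move=> q0 le_n.
have C0 : 0 < #|cell q| by apply/card_gt0P; exists (mkcell (leqnn (Ordinal q0))).
have [pc [nc [fc [lc [rk [pcnc pcN ncN rkP]]]]]] := finite_chain C0.
(* Each core vertex brings [p] leaves; what is left beyond the two obligatory tail vertices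
   lengthens the tail. *)
pose t := n - 2 - #|core (cell q) (link q)| * p.+1.
have card_v : #|vtx (cell q) (link q) p t| = n.
  rewrite card_sum card_ord card_sum card_prod card_ord /t.
  have := card_core q; set m := #|core _ _| => le_m.
  have : m * p.+1 <= 7 * (q * q.+1) * p.+1 by rewrite leq_mul2r le_m orbT.
  rewrite -/m; lia.
pose tree a := gtree pc lc (@link_at q) (@switch_link q) card_v (bits_state a).
have gB := @bits_good q.
have tree_inj : injective (fun a : {ffun 'I_q -> bool} => tree a).
  move=> a b e; apply/ffunP/bits_inj.
  exact: (gtree_inj rkP (@switch_linkP q)) e.
exists [set tree a | a : {ffun 'I_q -> bool}]; split.
- by rewrite card_imset // card_ffun card_bool card_ord.
- by move=> _ /imsetP [a _ ->]; apply: (gtree_dc pcnc pcN ncN rkP (@switch_linkP q)).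
move=> _ _ T /imsetP [a _ ->] /imsetP [b _ ->] _ dcT sT Ts.
have [c gc [agree unique]] := gtree_between pcnc ncN rkP (@switch_linkP q)
  (@depth_link q) (gB a) (gB b) dcT sT Ts.
by case: (bits_between gc agree) => e; [left|right]; apply: unique.
Qed.

(** A Hamiltonian path, with [v - 1] as parent of [v]. *)
Lemma exists_dc_tree n k : (0 < n)%N -> (1 < k)%N -> exists T, dc_tree n k T.
Proof.
move=> n0 k1; pose rt := Ordinal n0.
pose par (v : 'I_n) : 'I_n := Ordinal (leq_ltn_trans (leq_pred v) (ltn_ord v)).
have rankP (v : 'I_n) : v != rt -> (par v < v)%N.
  by case: v => -[|v] vn //=; apply: contra_neq_ltn => // _; apply: val_inj.
exists (tree_of rt par); split; first split.
- exact: tree_of_connected rankP.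
- exact: tree_of_acyclic rankP.
move=> v; apply: leq_trans k1; rewrite degT_adjT.
pose next : 'I_n := insubd rt v.+1.
apply: (@leq_trans #|[set par v; next]|); last by rewrite cards2; case: (_ != _).
apply: subset_leq_card; apply/subsetP=> u; rewrite !inE (adjT_tree_of rankP).
case/orP=> /andP [nr /eqP e]; first by rewrite e eqxx.
apply/orP; right; apply/eqP/val_inj; have lt := rankP _ nr.
rewrite /next e val_insubd /= prednK ?ltn_ord //.
by apply: leq_ltn_trans lt.
Qed.


(** The square root of [m] is at most r + 1, hence at most 2q + 9: this is the origin of the 9. *)
Lemma Rpower2_sqrt_le (m r q : nat) : (m < r.+1 * r.+1)%N -> (r <= 2 * q + 8)%N ->
  Rle (Rpower 2 ((sqrt (INR m) - 9) / 2)) (INR (2 ^ q)%N).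
Proof.
move=> mr rq.
have -> : INR (2 ^ q)%N = Rpower 2 (INR q).
  rewrite Rpower_pow; last by Lra.lra.
  by elim: q {rq} => // q IH; rewrite expnS mult_INR IH.
apply: Rle_Rpower; first by Lra.lra.
have : Rle (sqrt (INR m)) (INR r.+1).
  rewrite -(sqrt_Rsqr (INR r.+1)); last exact: pos_INR.
  by apply: sqrt_le_1_alt; rewrite /Rsqr -mult_INR; apply: le_INR; lia.
have : Rle (INR r.+1) (INR (2 * q + 9)) by apply: le_INR; lia.
rewrite plus_INR mult_INR /=; Lra.lra.
Qed.

(* omega(DCMST_{n,k}) >= 2^((sqrt(floor((s-1)/2)) - 9)/2), s = floor((n-2)/(k-1)):
   stated as the existence of a clique of the 1-skeleton of that size. *)
Theorem theorem9 (n k : nat) :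
  (2 < n)%N -> (1 < k)%N -> (k < n)%N ->
  let s := ((n - 2) %/ (k - 1))%N in
  exists Q : {set {set Kedge n}},
    skeleton_clique n k Q /\
    Rle (Rpower 2 ((sqrt (INR ((s - 1) %/ 2)%N) - 9) / 2)) (INR #|Q|).
Proof.
move=> n2 k1 kn s; set m := ((s - 1) %/ 2)%N.
have [r [rm mr]] : exists r, (r * r <= m)%N /\ (m < r.+1 * r.+1)%N.
  by exists (Nat.sqrt m); have := Nat.sqrt_spec' m; lia.
(* This gives r <= 2q + 8, and 2q + 7 <= r once q > 0; then s > 2r^2 exceeds 7q(q + 1). *)
pose q := (r - 7)./2.
suff [Q [cQ dcQ adjQ]] : exists Q : {set {set Kedge n}},
    [/\ #|Q| = (2 ^ q)%N, forall T, T \in Q -> dc_tree n k T &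
      forall A B T, A \in Q -> B \in Q -> A != B -> dc_tree n k T ->
        A :&: B \subset T -> T \subset A :|: B -> T = A \/ T = B].
  exists Q; split; first exact: skeleton_clique_between.
  by rewrite cQ; apply: Rpower2_sqrt_le mr _; rewrite /q; lia.
(* For q = 0 there is no cell, but one tree is enough. *)
case: (posnP q) => [->|q0].
  have [T dcT] := exists_dc_tree (ltnW (ltnW n2)) k1.
  exists [set T]; rewrite cards1; split=> // [_ /set1P -> //|A B ? /set1P -> /set1P ->].
  by rewrite eqxx.
have ek : k = (k - 2).+2 by lia.
rewrite ek; apply: between_family => //.
(* Thus [s] core vertices, each with k - 2 leaves, fit beside two tail vertices. *)
have s_le : (s * (k - 1) <= n - 2)%N by apply: leq_trunc_div.
have qs : (7 * (q * q.+1) <= s)%N.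
  have r_ge : (2 * q + 7 <= r)%N by rewrite /q in q0 *; lia.
  have := leq_mul r_ge r_ge; have : (m * 2 <= s - 1)%N by apply: leq_trunc_div.
  nia.
have : (7 * (q * q.+1) * (k - 1) <= s * (k - 1))%N by rewrite leq_mul2r qs orbT.
by rewrite (_ : (k - 2).+1 = k - 1)%N; lia.
Qed.
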